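(* Let $\mathcal{X}=\{\mathbf{x}_1,\dots,\mathbf{x}_m\}\subset\mathbb{R}^d$, let $[m]=B\cup R$ be a partition, let $L_B,L_R$ be disjoint finite sets of group indices with $|L_R|\ge2$, and let $M>0$ be a fixed big constant. Let $k\in L_B$, $j\in R$, and $S=\{i_1,\dots,i_s\}\subseteq B$ be such that $\mathbf{x}_j\in\operatorname{conv}(\mathbf{x}_S)$. Then the inequality $$\sum_{i\in S}z_{ik}+\sum_{\ell\in L_R}z_{j\ell}\le s$$ defines a facet of $P_{\mathcal{I}}$ if and only if $S$ is minimal with respect to the property $\mathbf{x}_j\in\operatorname{conv}(\mathbf{x}_S)$, i.e. $\mathbf{x}_j\notin\operatorname{conv}(\mathbf{x}_{S'})$ for every $S'\subsetneq S$.
   Context: For $S\subseteq[m]$, $\mathbf{x}_S:=\{\mathbf{x}_i:i\in S\}$. The polyhedron $P_{\mathcal{I}}$ of the instance $\mathcal{I}=(\mathcal{X},B,R,L_B,L_R)$ is the convex hull of all points $(\mathbf{p},q,z)$, where $\mathbf{p}=(\mathbf{p}_{k\ell})_{k\in L_B,\ell\in L_R}$ with $\mathbf{p}_{k\ell}\in\mathbb{R}^d$, $q=(q_{k\ell})$ with $q_{k\ell}\in\mathbb{R}$, and $z=(z_{ik})_{(i,k)\in(B\times L_B)\cup(R\times L_R)}$ with $z_{ik}\in\{0,1\}$, satisfying: $\mathbf{p}_{k\ell}\cdot\mathbf{x}_i+q_{k\ell}\le M-(M+1)z_{ik}$ for all $i\in B,k\in L_B,\ell\in L_R$; $\mathbf{p}_{k\ell}\cdot\mathbf{x}_j+q_{k\ell}\ge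 -M+(M+1)z_{j\ell}$ for all $j\in R,\ell\in L_R,k\in L_B$; $\sum_{k\in L_B}z_{ik}\le 1$ for all $i\in B$; $\sum_{\ell\in L_R}z_{j\ell}\le1$ for all $j\in R$. Here $\cdot$ is the standard inner product. *)

(* Defs.v *)
From mathcomp Require Import all_boot all_order all_algebra.
From mathcomp Require Import classical_sets reals convex.

Set Implicit Arguments.
Unset Strict Implicit.
Unset Printing Implicit Defensive.

Import Order.TTheory GRing.Theory Num.Theory.
Local Open Scope classical_set_scope.
Local Open Scope ring_scope.

Definition convex_hull (R : realType) (V : lmodType R) (A : set V) : set V :=
  smallest (@convex_set R V) A.

Definition affinely_independent (R : realType) (V : vectType R) (s : seq V) :=
  if s is v0 :: s' then free [seq v - v0 | v <- s'] else true.

(* [affine_dim A n]: the affine hull of [A] has dimension [n], i.e. [A]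
   contains [n + 1] affinely independent points and no more. No [n] satisfies
   this when [A] is empty. *)
Definition affine_dim (R : realType) (V : vectType R) (A : set V) (n : nat) :=
  (exists s : seq V, [/\ affinely_independent s, {in s, forall v, A v}
                       & size s = n.+1]) /\
  (forall s : seq V, affinely_independent s -> {in s, forall v, A v} ->
     (size s <= n.+1)%N).

(* The inequality [f v <= b] is valid on [P] and the face it induces has
   dimension [dim P - 1]. Meant for linear [f]. *)
Definition defines_facet (R : realType) (V : vectType R) (P : set V)
    (f : V -> R) (b : R) :=
  (forall v, P v -> f v <= b) /\
  exists n, affine_dim P n.+1 /\ affine_dim [set v | P v /\ f v = b] n.

Definition dot (R : realType) (d : nat) (u v : 'rV[R]_d) : R :=
  \sum_(a < d) u ord0 a * v ord0 a.

(* The ambient space of the points [(p, q, z)]; the coordinates [z] are split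
   into those indexed by [B * LB] and those indexed by [Rd * LR]. [Rd] is the
   set of indices called R on paper; [LB] and [LR] are disjoint because they
   index different components. *)
Definition point (R : realType) (d m : nat) (B Rd : {set 'I_m})
    (LB LR : finType) : vectType R :=
  ({ffun LB * LR -> 'rV[R]_d} * {ffun LB * LR -> R^o} *
   ({ffun {i : 'I_m | i \in B} * LB -> R^o} *
    {ffun {j : 'I_m | j \in Rd} * LR -> R^o}))%type.

Section Coordinates.
Variables (R : realType) (d m : nat) (B Rd : {set 'I_m}) (LB LR : finType).
Implicit Type v : point R d B Rd LB LR.

Definition pcoord v (k : LB) (l : LR) : 'rV[R]_d := v.1.1 (k, l).
Definition qcoord v (k : LB) (l : LR) : R := v.1.2 (k, l).
Definition zB v (i : {i : 'I_m | i \in B}) (k : LB) : R := v.2.1 (i, k).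
Definition zR v (j : {j : 'I_m | j \in Rd}) (l : LR) : R := v.2.2 (j, l).

Definition feasible (x : 'I_m -> 'rV[R]_d) (M : R) :
    set (point R d B Rd LB LR) :=
  [set v |
    [/\ (forall (i : {i : 'I_m | i \in B}) k, zB v i k = 0 \/ zB v i k = 1) /\
        (forall j l, zR v j l = 0 \/ zR v j l = 1),
        forall (i : {i : 'I_m | i \in B}) k l,
          dot (pcoord v k l) (x (val i)) + qcoord v k l <= M - (M + 1) * zB v i k,
        forall (j : {j : 'I_m | j \in Rd}) l k,
          dot (pcoord v k l) (x (val j)) + qcoord v k l >= - M + (M + 1) * zR v j l,
        forall i, \sum_(k : LB) zB v i k <= 1
      & forall j, \sum_(l : LR) zR v j l <= 1]].

Definition polyhedron (x : 'I_m -> 'rV[R]_d) (M : R) :=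
  convex_hull (feasible x M).

End Coordinates.

Arguments polyhedron {R d m} B Rd LB LR x M.

(* Main.v *)
(* On a feasible point the [z]-coordinates encode separations: [z_ik = 1] and
   [z_jl = 1] force [p_kl . x + q_kl] to be [<= -1] at [x_i], [>= 1] at [x_j].
   When [x_j] lies in [conv x_S] this excludes [z_ik = 1] for all [i] in [S]
   together with [z_jl = 1], so the inequality is valid.

   If [S] is minimal, a vector space [W] containing all differences of points
   of the face contains every direction [(p, q, 0)], because [p = 0], [q = -2]
   has slack in all constraints. A [0/1] assignment of the [z] on the face thus
   matters only modulo [(p, q)]; by Gordan's theorem it extends to a feasible
   point as soon as each [x_j'] with [z_j'l = 1] is outside the convex hull of
   the blue points of every group [k']. Comparing such assignments gives
   [v - f(v) u] in [W] for a fixed [u], where [f] is the left-hand side. For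
   [z_j'l], [j' <> j], one removes from [S] a point [i] with [x_j'] outside
   [conv x_(S \ i)], and puts [x_j] in another red group, whence [2 <= #|LR|].

   If [x_j] lies in [conv x_S'] with [S'] a proper subset, every point of the
   face has [z_ik = 1] for [i] in [S \ S'], so the face has codimension at least
   two. *)

From HB Require Import structures.
Require Import Defs.
From mathcomp Require Import all_boot all_order all_algebra.
From mathcomp Require Import classical_sets reals convex.
From mathcomp Require Import boolp ring lra interval_inference.

Set Implicit Arguments.
Unset Strict Implicit.
Unset Printing Implicit Defensive.

Import Order.TTheory GRing.Theory Num.Theory.
Local Open Scope classical_set_scope.
Local Open Scope ring_scope.

(** * Affine dimension measured by spaces of directions *)

Section AffineDimension.
Variables (R : realType) (V : vectType R).
Implicit Types (A : set V) (U W : {vspace V}).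

Lemma affine_dim_inj A n n' : affine_dim A n -> affine_dim A n' -> n = n'.
Proof.
move=> [[s [si sA ss]] ub] [[s' [si' sA' ss']] ub'].
apply/eqP; rewrite -eqSS eqn_leq -ss -ss'.
by rewrite {1}ss' ub'//= ss ub//.
Qed.

Lemma affinely_independent_size A U (s : seq V) :
  (forall v w, A v -> A w -> v - w \in U) ->
  affinely_independent s -> {in s, forall v, A v} -> (size s <= (\dim U).+1)%N.
Proof.
move=> AU; case: s => [//|w s'] /= fs sA; rewrite ltnS.
rewrite -(size_map (fun v => v - w)) -(eqP fs); apply/dimvS/span_subvP.
by move=> _ /mapP[v vs ->]; apply: AU; apply: sA; rewrite inE ?eqxx// vs orbT.
Qed.

(** The hypotheses make [U] the smallest subspace containing the differences [v - v0]. While fewer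
    than [\dim U] independent differences are chosen, their span cannot contain all the others, so
    one more can be added. *)
Lemma affine_dim_directions A U v0 : A v0 ->
  (forall v w, A v -> A w -> v - w \in U) ->
  (forall W, (forall v, A v -> v - v0 \in W) -> (U <= W)%VS) ->
  affine_dim A (\dim U).
Proof.
move=> Av0 AU UW; split; last by move=> s; exact: affinely_independent_size.
suff [s [fs sA ss]] : exists s : seq V,
    [/\ free [seq v - v0 | v <- s], {in s, forall v, A v} & size s = \dim U].
  exists (v0 :: s); rewrite /= ss; split=> // v.
  by rewrite inE => /orP[/eqP->//|]; exact: sA.
suff H n : (n <= \dim U)%N -> exists s : seq V,
    [/\ free [seq v - v0 | v <- s], {in s, forall v, A v} & size s = n].
  exact: H.
elim: n => [_|n IH nU]; first by exists [::]; split=> //; rewrite nil_free.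
have [s [fs sA ss]] := IH (ltnW nU).
have [v Av vs] : exists2 v, A v & v - v0 \notin <<[seq v - v0 | v <- s]>>%VS.
  apply: contrapT => /forall2NP H.
  have : (U <= <<[seq v - v0 | v <- s]>>)%VS.
    by apply: UW => v Av; have [//|/negP/negPn] := H v.
  by move=> /dimvS; rewrite leqNgt (leq_ltn_trans (dim_span _))// size_map ss.
exists (v :: s); split=> [|w|]; first by rewrite /= free_cons vs.
  by rewrite inE => /orP[/eqP->//|]; exact: sA.
by rewrite /= ss.
Qed.

Lemma dim_proper U W v : (U <= W)%VS -> v \in W -> v \notin U ->
  (\dim U < \dim W)%N.
Proof.
move=> UW vW vU; rewrite (ltn_leqif (dimv_leqif_sup UW)).
by apply/negP => /subvP/(_ _ vW); apply/negP.
Qed.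

End AffineDimension.

(** * Convex hulls and convex combinations *)

Section ConvexHull.
Variables (R : realType) (V : lmodType R).
Implicit Type A C : set V.

(** Replaces weights carrying an interval type by real numbers with explicit bounds. *)
Lemma convex_setP C :
  @convex_set R V C <-> forall u v (t : R), 0 <= t <= 1 -> C u -> C v ->
    C (t *: u + (1 - t) *: v).
Proof.
split=> [cC u v t /andP[t0 t1] Cu Cv|cC u v t /set_mem Cu /set_mem Cv].
  have H : Itv.spec (@Itv.num_sem R) (Itv.Real `[Posz 0, Posz 1]) t.
    by rewrite /Itv.spec /= /Itv.num_sem /= in_itv /= t0 t1 num_real.
  have := cC u v (Itv.mk H) (mem_set Cu) (mem_set Cv).
  by move=> /set_mem.
apply/mem_set; apply: cC => //.
by rewrite ge0/= le1.
Qed.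

Lemma convex_hull_min A C :
  @convex_set R V C -> A `<=` C -> convex_hull A `<=` C.
Proof. by move=> cC AC v; apply. Qed.

Lemma sub_convex_hull A : A `<=` convex_hull A.
Proof. by move=> v Av C [_]; apply. Qed.

Lemma convex_convex_hull A : @convex_set R V (convex_hull A).
Proof.
apply/convex_setP => u v t t01 Hu Hv C [cC AC].
by apply: (convex_setP C).1 => //; [apply: Hu|apply: Hv].
Qed.

Lemma convex_hull_finP (I : finType) (x : I -> V) (T : {set I}) y :
  convex_hull (x @` [set` T]) y <->
  exists w : I -> R, [/\ forall i, 0 <= w i, forall i, i \notin T -> w i = 0,
    \sum_i w i = 1 & \sum_i w i *: x i = y].
Proof.
split.
  pose C : set V := [set y | exists w : I -> R, [/\ forall i, 0 <= w i,
    forall i, i \notin T -> w i = 0, \sum_i w i = 1 & \sum_i w i *: x i = y]].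
  apply: (@convex_hull_min _ C) => [|_ [i /= iT <-]].
    apply/convex_setP => _ _ t /andP[t0 t1] [w [w0 wT w1 <-]]
      [w' [w0' wT' w1' <-]].
    exists (fun i => t * w i + (1 - t) * w' i); split.
    - by move=> i; rewrite addr_ge0 ?mulr_ge0 ?subr_ge0.
    - by move=> i iT; rewrite wT// wT'// !mulr0 addr0.
    - by rewrite big_split/= -!mulr_sumr w1 w1' !mulr1 addrC subrK.
    - rewrite !scaler_sumr -big_split/=; apply: eq_bigr => i _.
      by rewrite scalerDl !scalerA.
  exists (fun i' => (i' == i)%:R); split=> [i'|i' i'T||].
  - exact: ler0n.
  - by have [E|//] := eqVneq; rewrite E iT in i'T.
  - by rewrite (bigD1 i)//= eqxx big1 ?addr0// => i' /negbTE->.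
  - by rewrite (bigD1 i)//= eqxx scale1r big1 ?addr0// => i' /negbTE->;
      rewrite scale0r.
move=> [w [w0 wT w1 <-]].
have cC := (convex_setP _).1 (@convex_convex_hull (x @` [set` T])).
have [i0 i0T] : exists i0, i0 \in T.
  apply/set0Pn; apply/eqP => T0; move: w1; rewrite big1 => [/eqP|i _].
    by rewrite eq_sym oner_eq0.
  by rewrite wT// T0 inE.
(* Generalized to partial sums, whose total weight need not be 1: each is its total weight times a
   point of the hull. When that weight is 0 the point is arbitrary; [x i0] serves at the start. *)
suff [s0 [c Cc E]] : 0 <= \sum_i w i /\
    exists2 c, convex_hull (x @` [set` T]) c &
      \sum_i w i *: x i = (\sum_i w i) *: c.
  by rewrite E w1 scale1r.
elim/big_rec2: _ => [|i y1 s _ [s0 [c Cc ->]]].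
  by split=> //; exists (x i0); rewrite ?scale0r//; apply: sub_convex_hull;
    exists i0.
have [iT|iT] := boolP (i \in T); last first.
  by rewrite wT// !add0r; split=> //; exists c; rewrite // scale0r add0r.
split; first exact: addr_ge0.
have [ws0|ws0] := eqVneq (w i + s) 0.
  have /eqP := ws0; rewrite paddr_eq0// => /andP[/eqP-> /eqP->].
  by exists c => //; rewrite addr0 !scale0r addr0.
exists ((w i / (w i + s)) *: x i + (1 - w i / (w i + s)) *: c).
  apply: cC => //; last by apply: sub_convex_hull; exists i.
  by rewrite divr_ge0 ?addr_ge0//= ler_pdivrMr ?lt0r ?ws0 ?addr_ge0// mul1r
    lerDl.
rewrite scalerDr !scalerA; congr (_ *: _ + _ *: _); by field.
Qed.

Lemma convex_hullS (I : finType) (x : I -> V) (S T : {set I}) y : S \subset T ->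
  convex_hull (x @` [set` S]) y -> convex_hull (x @` [set` T]) y.
Proof.
move=> ST; apply: convex_hull_min; first exact: convex_convex_hull.
by move=> _ [i /= iS <-]; apply: sub_convex_hull; exists i => //=;
  exact: (fintype.subsetP ST).
Qed.

Lemma convex_hull_set1 (I : finType) (x : I -> V) (i : I) y :
  convex_hull (x @` [set` [set i]%SET]) y -> y = x i.
Proof.
move=> /convex_hull_finP[w [_ w0 w1 <-]].
have wi i' : i' != i -> w i' = 0 by move=> i'i; apply: w0; rewrite inE.
have w1i : w i = 1 by rewrite -w1 (bigD1 i)//= big1 ?addr0// => i' /wi.
by rewrite (bigD1 i)//= w1i scale1r big1 ?addr0// => i' /wi->; rewrite scale0r.
Qed.

End ConvexHull.

(** * The inner product and Gordan's theorem *)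

Section Dot.
Variables (R : realType) (d : nat).
Implicit Types u v w : 'rV[R]_d.

Lemma dotC u v : dot u v = dot v u.
Proof. by apply: eq_bigr => a _; rewrite mulrC. Qed.

Lemma dotDr u v w : dot u (v + w) = dot u v + dot u w.
Proof. by rewrite -big_split; apply: eq_bigr => a _; rewrite mxE mulrDr. Qed.

Lemma dotZr u t v : dot u (t *: v) = t * dot u v.
Proof. by rewrite mulr_sumr; apply: eq_bigr => a _; rewrite mxE mulrCA. Qed.

Lemma dotBr u v w : dot u (v - w) = dot u v - dot u w.
Proof. by rewrite -scaleN1r dotDr dotZr mulN1r. Qed.

Lemma dotDl u v w : dot (u + v) w = dot u w + dot v w.
Proof. by rewrite !(dotC _ w) dotDr. Qed.

Lemma dotZl u t v : dot (t *: u) v = t * dot u v.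
Proof. by rewrite !(dotC _ v) dotZr. Qed.

Lemma dot0l v : dot 0 v = 0.
Proof. by apply: big1 => a _; rewrite mxE mul0r. Qed.

Lemma dot_sumr (I : finType) u (F : I -> 'rV[R]_d) :
  dot u (\sum_i F i) = \sum_i dot u (F i).
Proof.
rewrite /dot exchange_big/=; apply: eq_bigr => a _.
by rewrite summxE mulr_sumr.
Qed.

Lemma dot_self_gt0 v : v != 0 -> 0 < dot v v.
Proof.
move=> v0; rewrite lt0r sumr_ge0 ?andbT => [|a _]; last exact: sqr_ge0.
apply: contra_neq v0 => /eqP; rewrite psumr_eq0 => [/allP H|a _];
  last exact: sqr_ge0.
apply/rowP => a; rewrite mxE; apply/eqP.
by have := H a (mem_index_enum _); rewrite -expr2 sqrf_eq0.
Qed.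

(** Taking midpoints along a list also covers the empty [T], where no maximum exists. *)
Lemma between_finite (I : finType) (T : {set I}) (l : I -> R) (b : R) :
  (forall i, i \in T -> l i < b) -> exists2 t, t < b & forall i, i \in T -> l i
    < t.
Proof.
move=> lb; suff [t tb H] : exists2 t, t < b & forall i, i \in enum T -> l i < t.
  by exists t => // i iT; apply: H; rewrite mem_enum.
have {lb}: forall i, i \in enum T -> l i < b by move=> i;
  rewrite mem_enum => /lb.
elim: (enum T) => [|i s IH] H; first by exists (b - 1) => //;
  rewrite ltrBlDr ltrDl.
have [|t tb Ht] := IH; first by move=> i' i's; apply: H; rewrite inE i's orbT.
have lib := H i (mem_head _ _).
exists ((Num.max (l i) t + b) / 2).
  have : Num.max (l i) t < b by rewrite gt_max lib tb.
  lra.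
have mb : Num.max (l i) t < b by rewrite gt_max lib tb.
have m1 : l i <= Num.max (l i) t by rewrite le_max lexx.
have m2 : t <= Num.max (l i) t by rewrite le_max lexx orbT.
move=> i'; rewrite inE => /orP[/eqP->|/Ht]; lra.
Qed.

(** Induction on the size of [T]: remove [i0], take [p] positive on the remaining vectors, and split
    on the sign of [dot p (a i0)]. A negative sign calls for a second use of the induction
    hypothesis. *)
Lemma gordan (I : finType) (T : {set I}) (a : I -> 'rV[R]_d) :
  (exists p, forall i, i \in T -> 0 < dot p (a i)) \/
  (exists w : I -> R, [/\ forall i, 0 <= w i, forall i, i \notin T -> w i = 0,
     exists i, w i != 0 & \sum_i w i *: a i = 0]).
Proof.
have [n] := ubnP #|T|; elim: n => // n IH in T a * => Tn.
have [->|[i0 i0T]] := set_0Vmem T; first by left; exists 0 => i; rewrite inE.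
pose T' := (T :\ i0)%SET.
have T'n : (#|T'| < n)%N by move: Tn; rewrite (cardsD1 i0 T) i0T add1n ltnS.
have TE i : (i \in T) = (i == i0) || (i \in T').
  by rewrite !inE; have [->|_] := eqVneq i i0.
have [[p Hp]|[w [w0 wT [i1 wi1] wa]]] := IH T' a T'n; last first.
  right; exists w; split=> //; last by exists i1.
  by move=> i iT; apply: wT; rewrite inE negb_and iT orbT.
have [pi0|pi0|pi0] := ltgtP (dot p (a i0)) 0; last first.
- have [ai0|ai0] := eqVneq (a i0) 0.
    right; exists (fun i => (i == i0)%:R); split=> [i|i iT||].
    + exact: ler0n.
    + by have [E|//] := eqVneq; rewrite E i0T in iT.
    + by exists i0; rewrite eqxx oner_eq0.
    + by apply: big1 => i _; have [->|] := eqVneq;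
        rewrite ?ai0 ?scaler0 ?scale0r.
  (* Here [p] is orthogonal to [a i0]. The vector [a i0 + t *: p] is positive on [a i0] for every
     [t], and on [a i] once [t] exceeds [l i]. *)
  left; pose l i := - dot (a i0) (a i) / dot p (a i).
  have lb i : i \in T' -> l i < 1 + \sum_(i in T') `|l i|.
    move=> iT; rewrite (bigD1 i)//=; have := ler_norm (l i).
    have : 0 <= \sum_(i' in T' | i' != i) `|l i'| by apply: sumr_ge0 => i2 _;
      exact: normr_ge0.
    lra.
  have [t _ Ht] := between_finite lb.
  exists (a i0 + t *: p) => i; rewrite dotDl dotZl TE => /orP[/eqP->|iT].
    by rewrite pi0 mulr0 addr0 dot_self_gt0.
  move: (Ht i iT); rewrite /l ltr_pdivrMr ?Hp//; lra.
- by left; exists p => i; rewrite TE => /orP[/eqP->|/Hp].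
(* Positive combinations of [a i0] and [a i] (for [i] in [T']) that are orthogonal to [p]. A
   dependency among the [b i] expands to one among the [a i], with the coefficients of [a i0]
   collected. *)
pose b i := dot p (a i) *: a i0 - dot p (a i0) *: a i.
have [[r Hr]|[w [w0 wT [i1 wi1] wb]]] := IH T' b T'n; last first.
  right; exists (fun i => - dot p (a i0) * w i +
                          (i == i0)%:R * \sum_i w i * dot p (a i)).
  have wp i : 0 <= w i * dot p (a i).
    have [/Hp/ltW pi|/wT->] := boolP (i \in T'); last by rewrite mul0r.
    exact: mulr_ge0.
  have i1T : i1 \in T' by apply: contraNT wi1 => /wT->.
  split.
  - by move=> i; rewrite addr_ge0 ?mulr_ge0 ?oppr_ge0 ?(ltW pi0) ?ler0n
      ?sumr_ge0.
  - move=> i; rewrite TE negb_or => /andP[/negbTE-> /wT->].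
    by rewrite mulr0 mul0r addr0.
  - exists i0; rewrite eqxx mul1r wT ?mulr0 ?add0r; last by rewrite !inE eqxx.
    rewrite psumr_neq0//; apply/hasP; exists i1; first exact: mem_index_enum.
    by rewrite mulr_gt0 ?Hp// lt0r wi1 w0.
  - rewrite -[RHS]wb (eq_bigr (fun i => (- dot p (a i0) * w i) *: a i +
       (i == i0)%:R *: ((\sum_i w i * dot p (a i)) *: a i0))); last first.
      move=> i _; rewrite scalerDl -!scalerA.
      by have [->|] := eqVneq i i0; rewrite ?scale0r.
    rewrite big_split/= -scaler_suml.
    rewrite [X in _ + X *: _](_ : _ = 1); last first.
      by rewrite (bigD1 i0)//= eqxx big1 ?addr0// => i /negbTE->.
    rewrite scale1r scaler_suml -big_split/=; apply: eq_bigr => i _.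
    by rewrite /b scalerBr !scalerA addrC mulNr scaleNr [w i * dot p (a
      i0)]mulrC.
left.
have Hr' i : i \in T' -> dot p (a i0) * dot r (a i) < dot p (a i) * dot r (a
  i0).
  by move=> /Hr; rewrite /b dotBr !dotZr subr_gt0.
(* Positivity of [r + t *: p] bounds [t] from below on [T'] and from above at [i0]; positivity of
   [r] on the [b i] says that these bounds are compatible. *)
have [|t tb Ht] := @between_finite I T' (fun i => - dot r (a i) / dot p (a i))
    (dot r (a i0) / - dot p (a i0)).
  move=> i iT; rewrite ltr_pdivrMr ?Hp// mulrAC ltr_pdivlMr ?oppr_gt0//.
  by rewrite mulrNN mulrC [ltRHS]mulrC Hr'.
exists (r + t *: p) => i; rewrite dotDl dotZl TE => /orP[/eqP->|iT].
  move: tb; rewrite ltr_pdivlMr ?oppr_gt0//; lra.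
move: (Ht i iT); rewrite ltr_pdivrMr ?Hp//; lra.
Qed.

End Dot.

(** * Separation of a point from a finite convex hull *)

Section Separation.
Variables (R : realType) (d : nat) (I : finType) (x : I -> 'rV[R]_d).
Implicit Types (S T : {set I}) (y : 'rV[R]_d).

(** Gordan's theorem applied to the vectors [y - x i]: a nontrivial nonnegative dependency, once
    normalized, would put [y] in the hull. *)
Lemma separation T y : ~ convex_hull (x @` [set` T]) y ->
  exists p q, (forall i, i \in T -> dot p (x i) + q <= - 1) /\ 1 <= dot p y + q.
Proof.
move=> yT; have [[p Hp]|[w [w0 wT [i1 wi1] wa]]] := gordan T (fun i => y - x
  i); last first.
  exfalso; apply/yT/convex_hull_finP.
  have W0 : 0 < \sum_i w i.
    by rewrite (bigD1 i1)//= ltr_wpDr ?sumr_ge0// lt0r wi1 w0.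
  exists (fun i => w i / \sum_i w i); split=> [i|i /wT->||].
  - by rewrite divr_ge0// ltW.
  - by rewrite mul0r.
  - by rewrite -mulr_suml divff// gt_eqF.
  - rewrite (eq_bigr (fun i => (\sum_i w i)^-1 *: (w i *: x i))); last first.
      by move=> i _; rewrite scalerA mulrC.
    rewrite -scaler_sumr (_ : \sum_i w i *: x i = (\sum_i w i) *: y).
      by rewrite scalerA mulVf ?scale1r// gt_eqF.
    apply/esym/eqP; rewrite -subr_eq0 scaler_suml -sumrB -[X in _ == X]wa.
    by apply/eqP/eq_bigr => i _; rewrite scalerBr.
have [|t ty Ht] := @between_finite R I T (fun i => dot p (x i)) (dot p y).
  by move=> i /Hp; rewrite dotBr subr_gt0.
have D : 0 < dot p y - t by rewrite subr_gt0.
(* The affine rescaling that sends the value [t] to -1 and [dot p y] to 1. *)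
exists ((2 / (dot p y - t)) *: p), (- 1 - 2 / (dot p y - t) * t);
  split=> [i iT|].
  rewrite dotZl.
  have : 2 / (dot p y - t) * (dot p (x i) - t) <= 0.
    by rewrite mulr_ge0_le0 ?divr_ge0 ?(ltW D)// subr_le0 ltW// Ht.
  lra.
rewrite dotZl.
have : 2 / (dot p y - t) * (dot p y - t) = 2 by rewrite divfK// gt_eqF.
lra.
Qed.

(* Points of a minimal [S] are affinely independent: two different affine
   representations of [y'] would allow moving the weights of [y] until one of
   them vanishes. *)
Lemma minimal_hull_exclude S y y' : convex_hull (x @` [set` S]) y ->
  (forall S', S' \proper S -> ~ convex_hull (x @` [set` S']) y) ->
  exists2 i, i \in S & ~ convex_hull (x @` [set` S :\ i]%SET) y'.
Proof.
move=> /convex_hull_finP[l [l0 lS l1 ly]] Smin; apply: contrapT => /forall2NP H.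
have {}H i : i \in S -> convex_hull (x @` [set` S :\ i]%SET) y'.
  by move=> iS; have [//|/contrapT] := H i.
have pos (w : I -> R) : (forall i, 0 <= w i) -> \sum_i w i = 1 -> exists i : I,
  0 < w i.
  move=> w0 w1; apply: contrapT => /forallNP N.
  have : \sum_i w i = 0.
    by apply: big1 => i _; apply/le_anti; rewrite w0 andbT leNgt; apply/negP.
  by apply/eqP; rewrite w1 oner_eq0.
have [i0 li0] := pos _ l0 l1.
have i0S : i0 \in S by apply: contraLR li0 => /lS->; rewrite ltxx.
have /convex_hull_finP[w [w0 wS w1 wy]] := H _ i0S.
have [i1 wi1] := pos _ w0 w1.
have i1S : i1 \in S.
  by apply: contraLR wi1 => iS; rewrite wS ?ltxx// inE negb_and iS orbT.
have /convex_hull_finP[w' [w0' wS' w1' wy']] := H _ i1S.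
(* Both [w] and [w'] represent [y'], and [w'] vanishes at [i1] where [w] is positive, so [mu] has a
   negative entry. *)
pose mu i := w' i - w i.
have mu1 : mu i1 < 0 by rewrite /mu wS' ?sub0r ?oppr_lt0// !inE eqxx.
have muS i : i \notin S -> mu i = 0.
  by move=> iS; rewrite /mu wS ?wS' ?subrr// !inE negb_and iS orbT.
(* Ratio test: the least ratio is the longest step along [mu] that keeps all weights nonnegative,
   and it makes the weight at [i2] vanish. *)
have [i2 mu2 Hmin] := @Order.TotalTheory.arg_minP _ _ I i1 (fun i => mu i < 0)
  (fun i => l i / - mu i) mu1.
have i2S : i2 \in S by apply: contraLR mu2 => /muS->; rewrite ltxx.
apply: (Smin (S :\ i2)%SET); first by rewrite properD1.
apply/convex_hull_finP; exists (fun i => l i + l i2 / - mu i2 * mu i).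
have t0 : 0 <= l i2 / - mu i2 by rewrite divr_ge0// oppr_ge0 ltW.
split=> [i|i||].
- have [mi|mi] := ltP (mu i) 0; last by rewrite addr_ge0// mulr_ge0.
  by have := Hmin i mi; rewrite ler_pdivlMr ?oppr_gt0// mulrN -subr_ge0 opprK.
- rewrite !inE negb_and negbK => /orP[/eqP->|iS].
    by rewrite invrN mulrN mulNr divfK ?subrr// lt_eqF.
  by rewrite (lS _ iS) (muS _ iS) mulr0 addr0.
- by rewrite big_split/= l1 -mulr_sumr sumrB w1 w1' subrr mulr0 addr0.
- rewrite (eq_bigr (fun i => l i *: x i + (l i2 / - mu i2) *: (w' i *: x i - w
    i *: x i))).
    by rewrite big_split/= ly -scaler_sumr sumrB wy wy' subrr scaler0 addr0.
  by move=> i _; rewrite scalerDl -!scalerA scalerBl.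
Qed.

End Separation.

(** * Criteria for being or not being a facet of a full-dimensional set *)

Section Facets.
Variables (R : realType) (V : vectType R) (P : set V) (f : V -> R^o) (b : R).
Hypotheses (f_lin : linear f) (P_full : affine_dim P (\dim {:V})).

Lemma linear_hom (g : V -> R^o) : linear g ->
  exists h : 'Hom(V, R^o), forall v, g v = h v.
Proof.
move=> g_lin.
pose h := HB.pack_for {linear V -> R^o} g (GRing.isLinear.Build R V R^o *:%R g
  g_lin).
by exists (linfun h) => v; rewrite lfunE.
Qed.

(** Since [f u = 1], the map sending [v] to [v - f v *: u] projects onto the kernel of [f]. The
    hypothesis on [W] thus says that the directions of the face span that kernel, a hyperplane. *)
Lemma defines_facet_directions u v0 : P v0 -> f v0 = b -> f u = 1 ->
  (forall v, P v -> f v <= b) ->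
  (forall W : {vspace V}, (forall v, P v -> f v = b -> v - v0 \in W) ->
     forall v, v - f v *: u \in W) ->
  defines_facet P f b.
Proof.
move=> Pv0 fv0 fu fb H; split=> //.
have [h fE] := linear_hom f_lin.
exists (\dim (lker h)); split.
  suff -> : (\dim (lker h)).+1 = \dim {:V} by [].
  apply/eqP; rewrite eqn_leq (@dim_proper _ _ _ _ u) ?subvf ?memvf//=;
    last first.
    by rewrite memv_ker -fE fu oner_eq0.
  have : ({:V} <= lker h + <[u]>)%VS.
    apply/subvP => v _; rewrite -(subrK (f v *: u) v) memv_add// ?memvZ
      ?memv_line//.
    by rewrite memv_ker linearB linearZ/= -!fE fu [_ *: _]mulr1 subrr.
  move=> /dimvS/leq_trans-> //; rewrite (leq_trans (dimv_add_leqif _ _))//.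
  by rewrite dim_vline addnC; case: eqP.
apply: (@affine_dim_directions _ _ _ _ v0) => //= [v w [_ fv] [_ fw]|W HW].
  by rewrite memv_ker linearB /= -!fE fv fw subrr.
apply/subvP => v; rewrite memv_ker -fE => /eqP fv0'.
have := H W _ v; rewrite fv0' scale0r subr0; apply.
by move=> w Pw fw; apply: HW.
Qed.

(** The directions of the face lie in the kernels of both [f] and [g]; [u1] and [u2] witness that
    this intersection has codimension at least two. *)
Lemma not_defines_facet (g : V -> R^o) c u1 u2 : linear g ->
  (forall v, P v -> f v = b -> g v = c) ->
  f u1 <> 0 -> f u2 = 0 -> g u2 <> 0 -> ~ defines_facet P f b.
Proof.
move=> g_lin Fg fu1 fu2 gu2 [_ [n [Pn [[s [si sF ss]] _]]]].
have [h fE] := linear_hom f_lin; have [h' gE] := linear_hom g_lin.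
have nV := affine_dim_inj P_full Pn.
have := @affinely_independent_size _ _ _ (lker h :&: lker h')%VS s _ si sF.
rewrite ss => H; have {}H : (n < (\dim (lker h :&: lker h')).+1)%N.
  apply: H => v w [Pv fv] [Pw fw].
  by rewrite memv_cap !memv_ker !linearB /= -!fE -!gE fv fw !Fg// !subrr eqxx.
have H1 : (\dim (lker h :&: lker h') < \dim (lker h))%N.
  apply: (@dim_proper _ _ _ _ u2);
    rewrite ?capvSl// ?memv_cap !memv_ker -fE fu2 ?eqxx//.
  by rewrite -gE; apply/eqP.
have : (\dim (lker h) < \dim {:V})%N.
  by apply: (@dim_proper _ _ _ _ u1); rewrite ?subvf ?memvf// memv_ker -fE;
    apply/eqP.
by rewrite nV ltnS leqNgt (leq_ltn_trans _ H1).
Qed.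

End Facets.

(** * Points with prescribed 0/1 coordinates and their feasibility *)

Section Instance.
Variables (R : realType) (d m : nat) (x : 'I_m -> 'rV[R]_d).
Variables (B Rd : {set 'I_m}) (LB LR : finType).
Local Notation pt := (Defs.point R d B Rd LB LR).

(** Assignments are boolean functions on all of ['I_m], which spares membership proofs; values
    outside [B] and [Rd] are ignored. *)
Definition mkpt (p : LB -> LR -> 'rV[R]_d) (q : LB -> LR -> R)
    (zb : 'I_m -> LB -> bool) (zr : 'I_m -> LR -> bool) : pt :=
  (([ffun t => p t.1 t.2], [ffun t => q t.1 t.2]),
   ([ffun t => (zb (val t.1) t.2)%:R], [ffun t => (zr (val t.1) t.2)%:R])).

Local Notation none := (fun _ _ => false).
Local Notation zpt := (mkpt (fun _ _ => 0) (fun _ _ => 0)).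

Lemma pointP (v w : pt) :
  (forall k l, pcoord v k l = pcoord w k l) ->
  (forall k l, qcoord v k l = qcoord w k l) ->
  (forall i k, zB v i k = zB w i k) -> (forall j l, zR v j l = zR w j l) -> v =
    w.
Proof.
case: v w => [[v1 v2] [v3 v4]] [[w1 w2] [w3 w4]] /= H1 H2 H3 H4.
congr ((_, _), (_, _)); apply/ffunP => -[a c].
- exact: H1.
- exact: H2.
- exact: H3.
- exact: H4.
Qed.

Lemma pcoord_lin a (v w : pt) k l : pcoord (a *: v + w) k l = a *: pcoord v k l
  + pcoord w k l.
Proof. by rewrite /pcoord !ffunE. Qed.
Lemma qcoord_lin a (v w : pt) k l : qcoord (a *: v + w) k l = a * qcoord v k l
  + qcoord w k l.
Proof. by rewrite /qcoord !ffunE. Qed.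
Lemma zB_lin a (v w : pt) i k : zB (a *: v + w) i k = a * zB v i k + zB w i k.
Proof. by rewrite /zB !ffunE. Qed.
Lemma zR_lin a (v w : pt) j l : zR (a *: v + w) j l = a * zR v j l + zR w j l.
Proof. by rewrite /zR !ffunE. Qed.

Lemma pcoord_mkpt p q zb zr k l : pcoord (mkpt p q zb zr) k l = p k l.
Proof. by rewrite /pcoord ffunE. Qed.
Lemma qcoord_mkpt p q zb zr k l : qcoord (mkpt p q zb zr) k l = q k l.
Proof. by rewrite /qcoord ffunE. Qed.
Lemma zB_mkpt p q zb zr i k : zB (mkpt p q zb zr) i k = (zb (val i) k)%:R.
Proof. by rewrite /zB ffunE. Qed.
Lemma zR_mkpt p q zb zr j l : zR (mkpt p q zb zr) j l = (zr (val j) l)%:R.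
Proof. by rewrite /zR ffunE. Qed.

Definition coords_lin := (pcoord_lin, qcoord_lin, zB_lin, zR_lin).
Definition coords_mkpt := (pcoord_mkpt, qcoord_mkpt, zB_mkpt, zR_mkpt).

Lemma sum_bool_le1 (K : finType) (b : K -> bool) :
  (forall k k', b k -> b k' -> k = k') -> \sum_k (b k)%:R <= 1 :> R.
Proof.
move=> ub; have [k bk|b0] := pickP b; last first.
  by rewrite big1 ?ler01// => k _; rewrite b0.
rewrite (bigD1 k)//= bk big1 ?addr0// => k' k'k.
by case bk': (b k') => //; rewrite (ub _ _ bk bk') eqxx in k'k.
Qed.

Lemma feasible_mkpt (M : R) p q zb zr :
  (forall i, i \in B -> forall k l,
     dot (p k l) (x i) + q k l <= if zb i k then - 1 else M) ->
  (forall j, j \in Rd -> forall k l,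
     (if zr j l then 1 else - M) <= dot (p k l) (x j) + q k l) ->
  (forall i k k', zb i k -> zb i k' -> k = k') ->
  (forall j l l', zr j l -> zr j l' -> l = l') ->
  feasible x M (mkpt p q zb zr).
Proof.
move=> HB HR ub ur; split.
- split=> [i k|j l]; rewrite coords_mkpt.
    by case: (zb _ _); [right|left].
  by case: (zr _ _); [right|left].
- move=> i k l; rewrite !coords_mkpt.
  have := HB _ (valP i) k l; case: (zb _ _) => /=; lra.
- move=> j l k; rewrite !coords_mkpt.
  have := HR _ (valP j) k l; case: (zr _ _) => /=; lra.
- move=> i; rewrite (eq_bigr (fun k => (zb (val i) k)%:R)).
    by apply: sum_bool_le1 => k k'; exact: ub.
  by move=> k _; rewrite coords_mkpt.
- move=> i; rewrite (eq_bigr (fun k => (zr (val i) k)%:R)).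
    by apply: sum_bool_le1 => k k'; exact: ur.
  by move=> k _; rewrite coords_mkpt.
Qed.

(** The sense in which [M] is big: whenever a separator exists, one exists whose values at all data
    points respect the bound [M]. *)
Definition separable (M : R) := forall (T : {set 'I_m}) j,
  ~ convex_hull (x @` [set` T]) (x j) ->
  exists p q, [/\ forall i, `|dot p (x i) + q| <= M,
    forall i, i \in T -> dot p (x i) + q <= - 1 & 1 <= dot p (x j) + q].

(** There are finitely many pairs [(T, j)]; one separator is chosen for each, and the sum of all
    their absolute values is a common bound. *)
Lemma separable_large : exists M0 : R, forall M, M0 <= M -> separable M.
Proof.
have H (t : {set 'I_m} * 'I_m) : exists pq : 'rV[R]_d * R,
    ~ convex_hull (x @` [set` t.1]) (x t.2) ->
    (forall i, i \in t.1 -> dot pq.1 (x i) + pq.2 <= - 1) /\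
    1 <= dot pq.1 (x t.2) + pq.2.
  have [h|/separation[p [q [H1 H2]]]] := pselect (convex_hull (x @` [set` t.1])
    (x t.2)).
    by exists 0.
  by exists (p, q).
have [g Hg] := choice H.
exists (\sum_t \sum_i `|dot (g t).1 (x i) + (g t).2|) => M HM T j /(Hg (T,
  j))[H1 H2].
exists (g (T, j)).1, (g (T, j)).2; split=> // i; apply: le_trans HM.
rewrite (bigD1 (T, j))//= (bigD1 i)//= -addrA lerDl addr_ge0//.
  by apply: sumr_ge0 => i' _; exact: normr_ge0.
by apply: sumr_ge0 => t _; apply: sumr_ge0 => i' _; exact: normr_ge0.
Qed.

(** For fixed 0/1 values the constraints decouple over the pairs [(k, l)]. A red group holds at most
    one point, so each pair only asks to separate one point from a hull. *)
Lemma feasible_exists (M : R) (zb : 'I_m -> LB -> bool) (zr : 'I_m -> LR ->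
  bool) :
  3 <= M -> separable M ->
  (forall i k k', zb i k -> zb i k' -> k = k') ->
  (forall j l l', zr j l -> zr j l' -> l = l') ->
  (forall j j' l, zr j l -> zr j' l -> j = j') ->
  (forall k l j, zr j l ->
     ~ convex_hull (x @` [set` [set i | zb i k]%SET]) (x j)) ->
  exists p q, feasible x M (mkpt p q zb zr).
Proof.
move=> M3 sepM ub ur ur' sep.
have H (t : LB * LR) : exists pq : 'rV[R]_d * R,
    [/\ forall i, `|dot pq.1 (x i) + pq.2| <= M,
      forall i, zb i t.1 -> dot pq.1 (x i) + pq.2 <= - 1 &
      forall j, zr j t.2 -> 1 <= dot pq.1 (x j) + pq.2].
  have [j zj|zr0] := pickP (fun j => zr j t.2); last first.
    (* With the red group empty, the constant function -1 meets every blue demand. *)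
    exists (0, - 1); split=> [i|i _|j]; rewrite ?zr0//= dot0l add0r//.
    by rewrite normrN normr1; lra.
  have [p [q [H1 H2 H3]]] := sepM _ _ (sep t.1 t.2 j zj).
  exists (p, q); split=> // [i zi|j' zj']; first by apply: H2; rewrite inE.
  by rewrite (ur' _ _ _ zj' zj).
have [g Hg] := choice H.
exists (fun k l => (g (k, l)).1), (fun k l => (g (k, l)).2).
apply: feasible_mkpt => // [i _ k l|j _ k l]; have [H1 H2 H3] := Hg (k, l).
  case: ifP => [/H2//|_]; exact: le_trans (ler_norm _) (H1 i).
case: ifP => [/H3//|_].
by have := H1 j; rewrite ler_norml => /andP[].
Qed.

(** With no red point assigned, the constant -2 is at distance at least 1 from both bounds -1 and
    [- M], as [3 <= M]. Hence every direction [(p, q, 0)] can be followed a little way. *)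
Lemma zero_binary_directions (W : {vspace pt}) v0 (M : R)
    (zb : 'I_m -> LB -> bool) :
  3 <= M -> (forall i k k', zb i k -> zb i k' -> k = k') ->
  (forall p q, let v := mkpt p q zb none in
     feasible x M v -> v - v0 \in W) ->
  forall p q, mkpt p q none none \in W.
Proof.
move=> M3 ub HW p q.
pose S (k : LB) (l : LR) i := `|dot (p k l) (x i) + q k l|.
(* Chosen so that a step of length [N^-1] changes every constraint by at most 1; the points at
   [N^-1] and at 0 are then subtracted and rescaled by [N]. *)
pose N := 1 + \sum_k \sum_l \sum_i S k l i.
have SN k l i : S k l i <= N.
  rewrite /N (bigD1 k)//= (bigD1 l)//= (bigD1 i)//=.
  have H1 : 0 <= \sum_(i' | i' != i) S k l i' by apply: sumr_ge0 => *;
    exact: normr_ge0.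
  have H2 : 0 <= \sum_(l' | l' != l) \sum_i S k l' i.
    by apply: sumr_ge0 => *; apply: sumr_ge0 => *; exact: normr_ge0.
  have H3 : 0 <= \sum_(k' | k' != k) \sum_l \sum_i S k' l i.
    apply: sumr_ge0 => *; apply: sumr_ge0 => *; apply: sumr_ge0 => *;
      exact: normr_ge0.
  lra.
have N0 : 0 < N.
  rewrite ltr_wpDr// sumr_ge0// => *; apply: sumr_ge0 => *.
  by apply: sumr_ge0 => *; exact: normr_ge0.
have feas (t : R) : 0 <= t <= N^-1 -> feasible x M
    (mkpt (fun k l => t *: p k l) (fun k l => - 2 + t * q k l) zb none).
  move=> /andP[t0 tN].
  have H k l i : `|t * (dot (p k l) (x i) + q k l)| <= 1.
    rewrite normrM ger0_norm// (@le_trans _ _ (N^-1 * N))//; last first.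
      by rewrite mulVf// gt_eqF.
    by apply: ler_pM => //; exact: SN.
  apply: feasible_mkpt => // [i _ k l|j _ k l]; rewrite dotZl.
    by have := H k l i; rewrite ler_norml; case: ifP => _; lra.
  by have := H k l j; rewrite ler_norml; lra.
have N10 : 0 <= N^-1 by rewrite invr_ge0 ltW.
have /HW W1 := feas N^-1 ltac:(by rewrite N10 lexx).
have /HW W2 := feas 0 ltac:(by rewrite N10 lexx).
have := memvZ N (memvB W1 W2); congr (_ \in W).
rewrite opprB addrA subrK.
apply: pointP => *; rewrite /pcoord /qcoord /zB /zR /= !ffunE /=.
- by rewrite scale0r subr0 scalerA divff ?scale1r// gt_eqF.
- rewrite [LHS]mulrDr mul0r addr0 opprK mulrDr mulrA divff ?mul1r;
    last by rewrite gt_eqF.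
  by rewrite addrAC -mulrDr addNr mulr0 add0r.
- by rewrite subrr scaler0.
- by rewrite subrr scaler0.
Qed.

(** The points [(p, q, 0)] and the unit vectors of the [z]-coordinates span the space. *)
Lemma point_ind (Q : pt -> Prop) :
  (forall a v w, Q v -> Q w -> Q (a *: v + w)) ->
  (forall p q, Q (mkpt p q none none)) ->
  (forall i k, i \in B -> Q (zpt (fun i' k' => (i' == i) && (k' == k)) none)) ->
  (forall j l, j \in Rd -> Q (zpt none
     (fun j' l' => (j' == j) && (l' == l)))) ->
  forall v, Q v.
Proof.
move=> Qlin Qpq QB QR v.
pose o : pt := zpt none none.
have Q0 : Q 0.
  suff <- : o = 0 by exact: Qpq.
  by apply: pointP => *; rewrite /pcoord /qcoord /zB /zR /= !ffunE.
have QD v1 v2 : Q v1 -> Q v2 -> Q (v1 + v2).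
  by move=> Q1 Q2; rewrite -[v1]scale1r; exact: Qlin.
have QZ a v1 : Q v1 -> Q (a *: v1) by move=> Q1; rewrite -[_ *: _]addr0;
  exact: Qlin.
have Qsum (I : finType) (F : I -> pt) : (forall t, Q (F t)) -> Q (\sum_t F t).
  by move=> QF; elim/big_ind: _.
pose eB (t : {i : 'I_m | i \in B} * LB) : pt :=
  zpt (fun i' k' => (i' == val t.1) && (k' == t.2)) none.
pose eR (t : {j : 'I_m | j \in Rd} * LR) : pt :=
  zpt none (fun i' k' => (i' == val t.1) && (k' == t.2)).
have -> : v = mkpt (pcoord v) (qcoord v) none none +
    \sum_t v.2.1 t *: eB t + \sum_t v.2.2 t *: eR t.
  apply: pointP => [k l|k l|i k|j l].
  - rewrite /pcoord /= !raddf_sum /= !ffunE !sum_ffunE /=.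
    rewrite !big1 ?addr0// => t _; first by rewrite !ffunE scaler0.
    by rewrite !ffunE scaler0.
  - rewrite /qcoord /= !raddf_sum /= !ffunE !sum_ffunE /=.
    rewrite !big1 ?addr0// => t _; first by rewrite !ffunE scaler0.
    by rewrite !ffunE scaler0.
  - rewrite /zB /= !raddf_sum /= !ffunE !sum_ffunE /= add0r.
    rewrite (bigD1 (i, k))//= !ffunE /= !eqxx [_ *: _]mulr1 !big1 ?addr0// => t.
      by rewrite !ffunE scaler0.
    move=> tik; rewrite !ffunE /= (_ : _ && _ = false) ?scaler0//.
    by apply: contraNF tik => /andP[/eqP/val_inj-> /eqP->]; case: (t).
  - rewrite /zR /= !raddf_sum /= !ffunE !sum_ffunE /= add0r.
    rewrite [X in X + _]big1 ?add0r; last by move=> t _; rewrite !ffunE scaler0.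
    rewrite (bigD1 (j, l))//= !ffunE /= !eqxx [_ *: _]mulr1 !big1 ?addr0// => t
      tjl.
    rewrite !ffunE /= (_ : _ && _ = false) ?scaler0//.
    by apply: contraNF tjl => /andP[/eqP/val_inj-> /eqP->]; case: (t).
apply: (QD); first apply: QD => //.
  by apply: Qsum => t; apply: QZ; apply: QB; exact: valP.
by apply: Qsum => t; apply: QZ; apply: QR; exact: valP.
Qed.

(** * Validity of the inequality, and reduction to 0/1 assignments *)

Definition lhs (S : {set 'I_m}) (k : LB) (j : {j : 'I_m | j \in Rd})
    (v : pt) : R^o :=
  \sum_(i : {i : 'I_m | i \in B} | val i \in S) zB v i k +
  \sum_(l : LR) zR v j l.

Lemma lhs_linear S k j : linear (lhs S k j).
Proof.
move=> a v w; rewrite /lhs scalerDr !scaler_sumr addrACA -!big_split /=.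
by congr (_ + _); apply: eq_bigr => t _; rewrite coords_lin.
Qed.

Lemma lhs_mkpt (S : {set 'I_m}) k j p q zb zr : S \subset B ->
  lhs S k j (mkpt p q zb zr) =
    \sum_(i in S) (zb i k)%:R + \sum_l (zr (val j) l)%:R.
Proof.
move=> SB; rewrite /lhs; congr (_ + _); last first.
  by apply: eq_bigr => l _; rewrite coords_mkpt.
under eq_bigr do rewrite coords_mkpt.
rewrite -(big_sub_cond (mem B) (fun i => i \in S) (fun i => (zb i k)%:R)).
apply: eq_bigl => i; rewrite andbC; case iS: (i \in S) => //=.
exact: (fintype.subsetP SB _ iS).
Qed.

(** A half-space is convex, so validity need only be checked on feasible points. *)
Lemma polyhedron_le (M : R) (f : pt -> R^o) (b : R) : linear f ->
  (forall v, feasible x M v -> f v <= b) ->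
  forall v, polyhedron B Rd LB LR x M v -> f v <= b.
Proof.
move=> f_lin fb; pose C : set pt := [set v | f v <= b].
apply: (@convex_hull_min _ _ _ C) => //; apply/convex_setP => u v t.
move=> /andP[t0 t1] Cu Cv; have [h fE] := linear_hom f_lin.
rewrite /C /= fE linearD !linearZ /= -!fE.
have H1 : t * f u <= t * b by exact: ler_wpM2l.
have H2 : (1 - t) * f v <= (1 - t) * b by apply: ler_wpM2l => //;
  rewrite subr_ge0.
rewrite -[t *: _]/(t * _) -[(1 - t) *: _]/((1 - t) * _); lra.
Qed.

Lemma zB_linear i k : linear (fun v : pt => zB v i k : R^o).
Proof. by move=> a v w; rewrite coords_lin. Qed.

Lemma zB_le1 (M : R) v i k : polyhedron B Rd LB LR x M v -> zB v i k <= 1.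
Proof.
apply: (polyhedron_le (zB_linear i k)) => {}v [[H _] _ _ _ _].
by have [->|->] := H i k; rewrite ?ler01.
Qed.

Lemma lhs_le (M : R) (S : {set 'I_m}) k j v : S \subset B ->
  convex_hull (x @` [set` S]) (x (val j)) ->
  polyhedron B Rd LB LR x M v -> lhs S k j v <= #|S|%:R.
Proof.
move=> SB /convex_hull_finP[w [w0 wS w1 wx]].
apply: (polyhedron_le (lhs_linear S k j)) => {}v [[zB01 zR01] HB HR _ sR].
have cS : \sum_(i : {i : 'I_m | i \in B} | val i \in S) (1 : R) = #|S|%:R.
  rewrite -(big_sub_cond (mem B) (fun i => i \in S) (fun=> 1)) -sum1_card
    natr_sum.
  apply: eq_bigl => i; rewrite andbC; case iS: (i \in S) => //=.
  exact: (fintype.subsetP SB _ iS).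
have zle i : zB v i k <= 1 by have [->|->] := zB01 i k; rewrite ?ler01.
rewrite /lhs -cS.
(* A zero in the blue sum makes room for the red sum, which is at most 1. Without one, the affine
   function is at most -1 on [S], hence at [x_j], and the red sum vanishes. *)
have [[i [iS zi]]|all1] := pselect (exists i, val i \in S /\ zB v i k = 0).
  rewrite (bigD1 i)// [leRHS](bigD1 i)//= zi add0r addrC.
  by apply: lerD => //; exact: ler_sum.
rewrite [X in _ + X]big1 ?addr0; first exact: ler_sum.
move=> l _; have [//|zj] := zR01 j l; exfalso.
have := HR j l k; rewrite zj mulr1 -wx dot_sumr.
suff : \sum_i dot (pcoord v k l) (w i *: x i) + qcoord v k l <= - 1 by lra.
have -> : - 1 = \sum_i w i * (- 1 : R) by rewrite -mulr_suml w1 mul1r.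
have -> : qcoord v k l = \sum_i w i * qcoord v k l.
  by rewrite -mulr_suml w1 mul1r.
rewrite -big_split/=; apply: ler_sum => i _.
have [iS|iS] := boolP (i \in S); last by rewrite wS// dotZr !mul0r add0r.
rewrite dotZr -mulrDr; apply: ler_wpM2l => //.
have iB : i \in B by apply: (fintype.subsetP SB).
have zi : zB v (exist _ i iB) k = 1.
  by have [zi|//] := zB01 (exist _ i iB) k; exfalso; apply: all1;
    exists (exist _ i iB).
by have := HB (exist _ i iB) k l; rewrite zi /=; lra.
Qed.

(** The assignments that [feasible_exists] extends to feasible points; the third clause, one point
    per red group, is stronger than feasibility demands. *)
Definition separated (zb : 'I_m -> LB -> bool) (zr : 'I_m -> LR -> bool) :=
  [/\ forall i k k', zb i k -> zb i k' -> k = k',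
      forall j l l', zr j l -> zr j l' -> l = l',
      forall j j' l, zr j l -> zr j' l -> j = j' &
      forall k l j, zr j l ->
        ~ convex_hull (x @` [set` [set i | zb i k]%SET]) (x j)].

(** The predicate [tight] is left abstract to serve twice: always true for the dimension of the
    polyhedron, equality in the inequality for the face. The assignment [zb0] has no red point, as
    the perturbation around -2 requires. *)
Lemma binary_directions (W : {vspace pt}) v0 (M : R)
    (tight : ('I_m -> LB -> bool) -> ('I_m -> LR -> bool) -> Prop) zb0 :
  3 <= M -> separable M ->
  (forall p q zb zr, feasible x M (mkpt p q zb zr) -> tight zb zr ->
     mkpt p q zb zr - v0 \in W) ->
  separated zb0 none -> tight zb0 none ->
  (forall p q, mkpt p q none none \in W) /\
  (forall zb zr, separated zb zr -> tight zb zr ->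
     zpt zb zr - v0 \in W).
Proof.
move=> M3 sepM HW [ub0 _ _ _] t0.
have Wpq p q : mkpt p q none none \in W.
  apply: (zero_binary_directions M3 ub0 (v0 := v0)) => {}p {}q v fv.
  exact: HW fv t0.
split=> // zb zr [ub ur ur' sep] tz.
have [p [q fpq]] := feasible_exists M3 sepM ub ur ur' sep.
suff -> : zpt zb zr - v0 = mkpt p q zb zr - v0 -
    mkpt p q none none by rewrite memvB// HW.
rewrite addrAC; congr (_ - _).
apply: pointP => *; rewrite /pcoord /qcoord /zB /zR /= !ffunE /=.
- by rewrite subrr.
- by rewrite subrr.
- by rewrite subr0.
- by rewrite subr0.
Qed.

(** * Dimension of the polyhedron and of the face *)

Lemma separated0 (zb : 'I_m -> LB -> bool) :
  (forall i k k', zb i k -> zb i k' -> k = k') -> separated zb none.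
Proof. by split. Qed.

Lemma affine_dim_polyhedron (M : R) : 3 <= M -> separable M ->
  affine_dim (polyhedron B Rd LB LR x M) (\dim {:pt}).
Proof.
move=> M3 sepM.
pose v0 : pt := zpt none none.
have Pv v : feasible x M v -> polyhedron B Rd LB LR x M v.
  by apply: sub_convex_hull.
have Pv0 : polyhedron B Rd LB LR x M v0.
  by apply: Pv; apply: feasible_mkpt => // *; rewrite dot0l add0r; lra.
apply: (affine_dim_directions Pv0) => [*|W HW]; first exact: memvf.
have [|||Wpq Wz] := @binary_directions W v0 M (fun _ _ => True) none M3 sepM.
- by move=> p q zb zr fv _; apply: HW; exact: Pv.
- exact: separated0.
- by [].
have {}Wz zb zr : separated zb zr -> zpt zb zr \in W.
  by move=> s; rewrite -[X in X \in W](subrK v0) memvD ?Wz ?Wpq.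
apply/subvP => v _; elim/point_ind: v => [a v w vW wW||i k iB|j l jR].
- by rewrite memvD ?memvZ.
- exact: Wpq.
- apply: Wz; apply: separated0 => i' k1 k2.
  by move=> /andP[_ /eqP->] /andP[_ /eqP->].
- apply: Wz; split=> //.
  + by move=> j' l1 l2 /andP[_ /eqP->] /andP[_ /eqP->].
  + by move=> j1 j2 l' /andP[/eqP-> _] /andP[/eqP-> _].
  (* No blue point is assigned, and the hull of the empty set is empty. *)
  + move=> k' l' j' _ /convex_hull_finP[w [_ w0 + _]].
    rewrite big1 => [/esym/eqP|i _]; first by rewrite oner_eq0.
    by apply: w0; rewrite inE.
Qed.

(** The second equation on the face is [zB v i k = 1] for a point [i] of [S] outside [S']. It is
    independent of the first: [u2 - u1] annihilates the left-hand side but not this coordinate. *)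
Lemma not_minimal_not_facet (M : R) k j (S S' : {set 'I_m}) :
  3 <= M -> separable M -> S \subset B -> (0 < #|LR|)%N -> S' \proper S ->
  convex_hull (x @` [set` S']) (x (val j)) ->
  ~ defines_facet (polyhedron B Rd LB LR x M) (lhs S k j) #|S|%:R.
Proof.
move=> M3 sepM SB /card_gt0P[l _] /properP[S'S [i0 i0S i0S']] S'j.
have i0B := fintype.subsetP SB _ i0S.
pose i : {i : 'I_m | i \in B} := exist _ i0 i0B.
pose u1 : pt := zpt none (fun j' l' => (j' == val j) && (l' == l)).
pose u2 : pt := zpt (fun i' k' => (i' == i0) && (k' == k)) none.
have f1 : lhs S k j u1 = 1.
  rewrite lhs_mkpt// big1 ?add0r// (bigD1 l)//= !eqxx big1 ?addr0// => l'
    /negbTE->.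
  by rewrite andbF.
have f2 : lhs S k j u2 = 1.
  rewrite lhs_mkpt// [X in _ + X]big1 ?addr0// (bigD1 i0)//= !eqxx big1
    ?addr0//.
  by move=> i' /andP[_ /negbTE->].
have [h hE] := @linear_hom R pt (lhs S k j) (lhs_linear S k j).
have H := @not_defines_facet _ _ _ (lhs S k j) #|S|%:R (lhs_linear S k j)
  (affine_dim_polyhedron M3 sepM) (fun v => zB v i k : R^o) 1 u1 (u2 - u1)
    (zB_linear i k).
apply: H; rewrite ?f1 ?hE ?linearB/= -?hE ?f1 ?f2 ?subrr//; last 2 first.
- by apply/eqP; rewrite oner_eq0.
- by rewrite /zB /= !ffunE /= !eqxx subr0; apply/eqP; rewrite oner_eq0.
- move=> v Pv fv.
  have zle i' : zB v i' k <= 1 := zB_le1 i' k Pv.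
  apply/le_anti; rewrite zle /=.
  (* The inequality also holds for [S :\ i0]; subtracting it from the equation of the face leaves
     the lower bound 1 for the coordinate. *)
  have Tj : convex_hull (x @` [set` S :\ i0]%SET) (x (val j)).
    by apply: convex_hullS S'j; rewrite subsetD1 S'S.
  have := lhs_le k (fintype.subset_trans (subD1set S i0) SB) Tj Pv.
  rewrite /lhs (eq_bigl (fun i1 => (sval i1 \in S) && (i1 != i))); last first.
    by move=> i1; rewrite !inE andbC.
  move: fv; rewrite /lhs (bigD1 i)//= -addrA (cardsD1 i0 S) i0S natrD /=; lra.
Qed.

Lemma minimal_facet (M : R) k j (S : {set 'I_m}) :
  injective x -> (B :&: Rd)%SET = finset.set0 ->
  3 <= M -> separable M -> S \subset B -> (1 < #|LR|)%N ->
  convex_hull (x @` [set` S]) (x (val j)) ->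
  (forall S' : {set 'I_m}, S' \proper S ->
     ~ convex_hull (x @` [set` S']) (x (val j))) ->
  defines_facet (polyhedron B Rd LB LR x M) (lhs S k j) #|S|%:R.
Proof.
move=> x_inj BRd M3 sepM SB LR2 Sj Smin.
have jB : val j \notin B.
  by apply/negP => jB; have := finset.in_set0 (val j);
    rewrite -BRd inE jB (valP j).
have [l0 _] : exists l0, l0 \in LR by apply/card_gt0P; exact: ltnW.
pose u : pt := zpt none (fun j' l' => (j' == val j) && (l' == l0)).
pose zS i k' := (i \in S) && (k' == k).
pose v0 : pt := mkpt (fun _ _ => 0) (fun _ _ => -2) zS none.
have zSu i k1 k2 : zS i k1 -> zS i k2 -> k1 = k2.
  by move=> /andP[_ /eqP->] /andP[_ /eqP->].
have tightS : \sum_(i in S) (zS i k)%:R + \sum_(l : LR) 0 = #|S|%:R :> R.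
  rewrite [X in _ + X]big1// addr0 -sum1_card natr_sum.
  by apply: eq_bigr => i iS; rewrite /zS iS eqxx.
have Pv v : feasible x M v -> polyhedron B Rd LB LR x M v.
  by apply: sub_convex_hull.
have fu : lhs S k j u = 1.
  rewrite lhs_mkpt// big1 ?add0r// (bigD1 l0)//= !eqxx big1 ?addr0// => l'
    /negbTE->.
  by rewrite andbF.
apply: (@defines_facet_directions _ _ _ _ _ (lhs_linear S k j)
  (affine_dim_polyhedron M3 sepM) u v0) => //.
- apply: Pv; apply: feasible_mkpt => // [i _ k' l'|j' _ k' l']; rewrite dot0l.
    by case: ifP => _; lra.
  lra.
- by rewrite lhs_mkpt.
- by move=> v; exact: lhs_le.
move=> W HW.
pose tight (zb : 'I_m -> LB -> bool) (zr : 'I_m -> LR -> bool) :=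
  \sum_(i in S) (zb i k)%:R + \sum_l (zr (val j) l)%:R = #|S|%:R :> R.
have [|||Wpq Wz] := @binary_directions W v0 M tight zS M3 sepM.
- by move=> p q zb zr fv tz; apply: HW; [exact: Pv|rewrite lhs_mkpt].
- exact: separated0.
- exact: tightS.
pose dB i k' := fun i' k'' => (i' == i :> 'I_m) && (k'' == k' :> LB).
pose dR j' l := fun j1 l1 => (j1 == j' :> 'I_m) && (l1 == l :> LR).
(* Differences of [0/1] assignments, with both sides of [zb - zb' = zb1 - zb2]
   moved so that no subtraction occurs. *)
have Wd (zb : 'I_m -> LB -> bool) (zr : 'I_m -> LR -> bool)
    (zb' : 'I_m -> LB -> bool) (zr' : 'I_m -> LR -> bool)
    (zb1 : 'I_m -> LB -> bool) (zr1 : 'I_m -> LR -> bool)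
    (zb2 : 'I_m -> LB -> bool) (zr2 : 'I_m -> LR -> bool) :
    separated zb zr -> tight zb zr -> separated zb' zr' -> tight zb' zr' ->
    (forall i k', (zb i k' + zb2 i k' = zb1 i k' + zb' i k')%N) ->
    (forall j' l, (zr j' l + zr2 j' l = zr1 j' l + zr' j' l)%N) ->
    zpt zb1 zr1 - zpt zb2 zr2 \in W.
  move=> H1 H2 H3 H4 Ez Er.
  suff -> : zpt zb1 zr1 - zpt zb2 zr2 = (zpt zb zr - v0) - (zpt zb' zr' - v0).
    by rewrite memvB ?Wz.
  rewrite opprB addrA subrK; apply: pointP => *.
  - by rewrite /pcoord /= !ffunE.
  - by rewrite /qcoord /= !ffunE.
  - rewrite /zB /= !ffunE /=; apply/eqP; rewrite subr_eq addrAC eq_sym subr_eq.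
    by rewrite -!natrD Ez.
  - rewrite /zR /= !ffunE /=; apply/eqP; rewrite subr_eq addrAC eq_sym subr_eq.
    by rewrite -!natrD Er.
have We zb zr : zpt zb zr - zpt none none \in W -> zpt zb zr \in W.
  by move=> H; rewrite -[X in X \in W](subrK (zpt none none)) memvD ?Wpq.
(* All of [S] except [i0] in group [k]: together with [x_j] in one red group this is tight, and
   minimality of [S] makes it separated. *)
pose zD i0 i k' := [&& i \in S, i != i0 & k' == k].
have zDu i0 i k1 k2 : zD i0 i k1 -> zD i0 i k2 -> k1 = k2.
  by move=> /and3P[_ _ /eqP->] /and3P[_ _ /eqP->].
have zDS i0 k' : [set i | zD i0 i k']%SET \subset (S :\ i0)%SET.
  by apply/fintype.subsetP => i; rewrite !inE => /and3P[-> -> _].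
have zDj i0 k' : i0 \in S ->
    ~ convex_hull (x @` [set` [set i | zD i0 i k']%SET]) (x (val j)).
  move=> i0S /(convex_hullS (zDS _ _)); apply: Smin; exact: properD1.
have tightD i0 (zb : 'I_m -> LB -> bool) (zr : 'I_m -> LR -> bool) :
    i0 \in S -> {in S, forall i, zb i k = (i != i0)} ->
    \sum_l (zr (val j) l)%:R = 1 :> R -> tight zb zr.
  move=> i0S zbE zr1; rewrite /tight zr1 -sum1_card natr_sum (bigD1 i0)//=.
  rewrite [in RHS](bigD1 i0)//= zbE// eqxx add0r addrC; congr (_ + _).
  by apply: eq_bigr => i /andP[iS ii0]; rewrite zbE// ii0.
have dRu j' l j1 l1 l2 : dR j' l j1 l1 -> dR j' l j1 l2 -> l1 = l2.
  by move=> /andP[_ /eqP->] /andP[_ /eqP->].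
have dRu' j' l j1 j2 l1 : dR j' l j1 l1 -> dR j' l j2 l1 -> j1 = j2.
  by move=> /andP[/eqP-> _] /andP[/eqP-> _].
have dR1 l : \sum_l' (dR (val j) l (val j) l')%:R = 1 :> R.
  by rewrite (bigD1 l)//= /dR !eqxx big1 ?addr0// => l' /negbTE->;
    rewrite andbF.
have sepD i0 l : i0 \in S -> separated (zD i0) (dR (val j) l).
  move=> i0S; split=> [i|j'|j1|k' l' j' /andP[/eqP-> _]];
    [exact: zDu|exact: dRu|exact: dRu'|].
  exact: zDj.
have tightzD i0 l : i0 \in S -> tight (zD i0) (dR (val j) l).
  move=> i0S; apply: (tightD i0) => // i iS.
  by rewrite /zD iS eqxx andbT.
have [i1 i1S] : exists i, i \in S.
  by have [i iS _] := minimal_hull_exclude (x (val j)) Sj Smin; exists i.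
(* The point [i] left out of group [k] is put in [k'], where it is alone; its hull misses [x_j]
   because [x] is injective and [j] is not in [B]. *)
have bS i k' : i \in S -> k' != k -> zpt (dB i k') none \in W.
  move=> iS k'k; apply: We.
  apply: (Wd (fun i' k'' => zD i i' k'' || dB i k' i' k'') (dR (val j) l0)
    (zD i) (dR (val j) l0)) => //.
  - split=> [i' k1 k2|j'|j1|k1 l j' /andP[/eqP-> _]];
      [|exact: dRu|exact: dRu'|].
      rewrite /zD /dB; case: (eqVneq i' i) => [->|_]; rewrite ?andbF/= ?orbF.
        by move=> /eqP-> /eqP->.
      by move=> /andP[_ /eqP->] /andP[_ /eqP->].
    have [->|k1k] := eqVneq k1 k.
      move=> H; apply: (zDj i k iS); apply: convex_hullS H.
      apply/fintype.subsetP => i';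
        rewrite !inE /dB [k == k']eq_sym (negbTE k'k).
      by rewrite andbF orbF.
    move=> H.
    have /convex_hull_set1 : convex_hull (x @` [set` [set i]%SET]) (x (val j)).
      apply: convex_hullS H.
      apply/fintype.subsetP => i'; rewrite !inE /zD /dB (negbTE k1k) !andbF /=.
      by case/andP.
    by move=> /x_inj E; move: jB; rewrite E (fintype.subsetP SB).
  - apply: (tightD i) => // i' iS'.
    by rewrite /zD /dB iS' eqxx andbT [k == k']eq_sym (negbTE k'k) andbF orbF.
  - exact: sepD.
  - exact: tightzD.
  - move=> i' k''; rewrite /zD /dB addn0.
    by case: (eqVneq i' i) => [->|_]; rewrite ?iS ?(negbTE iS) /=;
      do ?case: (_ == _); do ?case: (_ \in _).
  - by move=> *; rewrite addn0.
(* Trades the blue unit at [i] for the red unit at [j], which keeps the sum equal to [s]. *)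
have bSk i : i \in S -> zpt (dB i k) none - u \in W.
  move=> iS; apply: (Wd zS none (zD i) (dR (val j) l0)) => //.
  - exact: sepD.
  - exact: tightzD.
  - move=> i' k''; rewrite /zD /dB /zS addn0.
    by case: (eqVneq i' i) => [->|_]; rewrite ?iS ?(negbTE iS) /=;
      do ?case: (_ == _); do ?case: (_ \in _).
(* With no red point assigned, a blue point outside [S] can join any group without affecting
   tightness. *)
have bnS i k' : i \notin S -> zpt (dB i k') none \in W.
  move=> iS; apply: We.
  apply: (Wd (fun i' k'' => zS i' k'' || dB i k' i' k'') none
    zS none) => //.
  - apply: separated0 => i' k1 k2; rewrite /zS /dB.
    case: (eqVneq i' i) => [->|_]; rewrite ?(negbTE iS)/= ?orbF.
      by move=> /eqP-> /eqP->.
    by move=> /andP[_ /eqP->] /andP[_ /eqP->].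
  - rewrite /tight -[RHS]tightS; congr (_ + _); apply: eq_bigr => i' iS'.
    by rewrite /zS iS' eqxx.
  - move=> i' k''; rewrite /zS /dB addn0.
    by case: (eqVneq i' i) => [->|_]; rewrite ?iS ?(negbTE iS) /=;
      do ?case: (_ == _); do ?case: (_ \in _).
have rj l : zpt none (dR (val j) l) - u \in W.
  apply: (Wd (zD i1) (dR (val j) l) (zD i1) (dR (val j) l0)) => //.
  - exact: sepD.
  - exact: tightzD.
  - exact: sepD.
  - exact: tightzD.
  - by move=> *; rewrite addn0.
(* Tightness keeps [x_j] in a red group, so it moves to some [l'] other than [l] to keep one point
   per group. The omitted [i0] is chosen so that [x_j'] too lies outside the hull. *)
have rnj j' l : j' != val j -> zpt none (dR j' l) \in W.
  move=> j'j; apply: We.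
  have [l' l'l] : exists l', l' != l.
    have := LR2; rewrite (cardD1 l) inE ltnS lt0n => /existsP[l'].
    by rewrite !inE andbT; exists l'.
  have [i0 i0S i0j'] := minimal_hull_exclude (x j') Sj Smin.
  apply: (Wd (zD i0) (fun j1 l1 => dR j' l j1 l1 || dR (val j) l' j1 l1)
    (zD i0) (dR (val j) l')) => //.
  - split.
    + exact: zDu.
    + move=> j1 l1 l2; rewrite /dR; case: (eqVneq j1 j') => [->|_] /=.
        by rewrite (negbTE j'j) !orbF => /eqP-> /eqP->.
      by move=> /andP[_ /eqP->] /andP[_ /eqP->].
    + move=> j1 j2 l1; rewrite /dR; case: (eqVneq l1 l) => [->|_].
        by rewrite [l == l']eq_sym (negbTE l'l) !andbT !andbF !orbF => /eqP->
          /eqP->.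
      by rewrite !andbF => /andP[/eqP-> _] /andP[/eqP-> _].
    + move=> k' l1 j1 /orP[/andP[/eqP-> _]|/andP[/eqP-> _]]; last exact: zDj.
      by move=> /(convex_hullS (zDS _ _)).
  - apply: (tightD i0) => // [i iS|]; first by rewrite /zD iS eqxx andbT.
    rewrite -[RHS](dR1 l'); apply: eq_bigr => l1 _.
    by rewrite /dR eq_sym (negbTE j'j).
  - exact: sepD.
  - exact: tightzD.
  - by move=> *; rewrite addn0.
  - move=> j1 l1; rewrite /dR addn0.
    by case: (eqVneq j1 j') => [->|_]; rewrite ?(negbTE j'j) /=;
      do ?case: (_ == _).
(* Stated for an abstract [V]: these rewrites diverge on the type [pt]. *)
have combE (V : lmodType R) (a b c : R) (v w u0 : V) :
    a *: v + w - (a * b + c) *: u0 = a *: (v - b *: u0) + (w - c *: u0).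
  by rewrite scalerDl opprD addrACA -scalerA -scalerBr.
elim/point_ind => [a v w vW wW|p q|i k' iB|j' l jR].
- have -> : lhs S k j (a *: v + w) = a * lhs S k j v + lhs S k j w.
    exact: lhs_linear.
  have E := combE pt a (lhs S k j v) (lhs S k j w) v w u.
  have : a *: (v - lhs S k j v *: u) + (w - lhs S k j w *: u) \in W.
    by apply: memvD; [apply: memvZ; exact: vW|exact: wW].
  by rewrite -E.
- by rewrite lhs_mkpt// !big1 ?addr0 ?scale0r ?subr0.
- rewrite lhs_mkpt// [X in (_ + X) *: _]big1 ?addr0//.
  have [iS|iS] := boolP (i \in S); last first.
    rewrite big1 ?scale0r ?subr0; first exact: bnS.
    by move=> i' iS'; case: eqVneq => // E; rewrite -E iS' in iS.
  rewrite (bigD1 i)//= eqxx big1 => [|i' /andP[_ /negbTE->]//].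
  rewrite addr0; have [->|k'k] := eqVneq k' k.
    by rewrite scale1r; exact: bSk.
  by rewrite scale0r subr0; exact: bS.
- rewrite lhs_mkpt// big1 ?add0r//; have [->|j'j] := eqVneq j' (val j).
    rewrite (bigD1 l)//= !eqxx big1 => [|l' /negbTE->//].
    by rewrite addr0 scale1r; exact: rj.
  rewrite big1 ?scale0r ?subr0; first exact: rnj.
  by [].
Qed.

End Instance.

Theorem theorem1 (R : realType) (d m : nat)
  (x : 'I_m -> 'rV[R]_d) (x_inj : injective x)
  (B Rd : {set 'I_m})
  (BRd_cover : (B :|: Rd)%SET = [set: 'I_m]%SET)
  (BRd_disj : (B :&: Rd)%SET = finset.set0)
  (LB LR : finType) (LR_ge2 : (2 <= #|LR|)%N) :
  exists M0 : R, 0 < M0 /\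
  forall M : R, M0 <= M ->
  forall (k : LB) (j : {j : 'I_m | j \in Rd}) (S : {set 'I_m}),
    S \subset B ->
    convex_hull (x @` [set` S]) (x (val j)) ->
    (defines_facet (polyhedron B Rd LB LR x M)
       (fun v => \sum_(i : {i : 'I_m | i \in B} | val i \in S) zB v i k
                 + \sum_(l : LR) zR v j l)
       #|S|%:R
     <->
     forall S' : {set 'I_m}, S' \proper S ->
       ~ convex_hull (x @` [set` S']) (x (val j))).
Proof.
have [M1 sepM1] := separable_large x.
(* The 3 leaves room for perturbing around -2, and [M1] bounds the chosen separators. *)
exists (Num.max 3 M1); split=> [|M]; first by rewrite lt_max ltr0n.
rewrite ge_max => /andP[M3 /sepM1 sepM] k j S SB Sj; split.
  move=> facetS S' S'S S'j.
  exact: (not_minimal_not_facet M3 sepM SB (ltnW LR_ge2) S'S S'j facetS).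
exact: minimal_facet.
Qed.
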